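(* Let $m\ge 1$ and let $G$ be a connected $2m$-regular bipartite graph. Then $\chi_{la}(G)=\chi_{la}(G-e)=3$ for every edge $e$ of $G$.
   Context: All graphs are finite and simple. For a graph $G=(V,E)$ with $q$ edges, a bijection $f:E\to\{1,\ldots,q\}$ is a local antimagic labeling if $f^+(u)\ne f^+(v)$ for all adjacent $u,v$, where $f^+(u)$ is the sum of labels of edges incident to $u$. $\chi_{la}(G)$ is the minimum number of distinct values of $f^+$ over all local antimagic labelings of $G$. $G-e$ is $G$ with the edge $e$ deleted. *)

(* Defs.v *)
From mathcomp Require Import all_boot.

Set Implicit Arguments.
Unset Strict Implicit.
Unset Printing Implicit Defensive.

Record sgraph := SGraph {
  vertex :> finType;
  adj : rel vertex;
  adj_sym : symmetric adj;
  adj_irrefl : irreflexive adj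
}.

Definition edges (G : sgraph) : {set {set G}} :=
  [set [set p.1; p.2] | p in [pred p : G * G | adj p.1 p.2]].

Definition connected_graph (G : sgraph) : Prop :=
  0 < #|G| /\ forall x y : G, connect (@adj G) x y.

Definition regular_graph (G : sgraph) (k : nat) : Prop :=
  forall x : G, #|[set y | adj x y]| = k.

Definition bipartite_graph (G : sgraph) : Prop :=
  exists A : {set G}, forall x y : G, adj x y -> (x \in A) != (y \in A).

Section DeleteEdge.

Variables (G : sgraph) (d : {set G}).

Definition del_adj : rel G := [rel x y | adj x y && ([set x; y] != d)].

Lemma del_adj_sym : symmetric del_adj.
Proof. by move=> x y; rewrite /del_adj /= adj_sym setUC. Qed.

Lemma del_adj_irrefl : irreflexive del_adj.
Proof. by move=> x; rewrite /del_adj /= adj_irrefl. Qed.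

Definition delete_edge : sgraph := SGraph del_adj_sym del_adj_irrefl.

End DeleteEdge.

(* The values of a labeling outside of the edge set are irrelevant. *)
Definition edge_labeling (G : sgraph) (f : {set G} -> nat) : Prop :=
  {in edges G &, injective f} /\
  [seq f d | d in edges G] =i iota 1 #|edges G|.

Definition vertex_sum (G : sgraph) (f : {set G} -> nat) (v : G) : nat :=
  \sum_(d in edges G | v \in d) f d.

Definition local_antimagic (G : sgraph) (f : {set G} -> nat) : Prop :=
  edge_labeling f /\
  forall u v : G, adj u v -> vertex_sum f u <> vertex_sum f v.

Definition num_colors (G : sgraph) (f : {set G} -> nat) : nat :=
  size (undup (codom (vertex_sum f))).

(* [chi_la G k] states that the minimum defining the local antimagic chromatic
   number exists and equals [k]; a relation is used because a graph such as K_2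
   has no local antimagic labeling. *)
Definition chi_la (G : sgraph) (k : nat) : Prop :=
  (exists2 f : {set G} -> nat, local_antimagic f & num_colors f = k) /\
  (forall f : {set G} -> nat, local_antimagic f -> k <= num_colors f).

(* Main.v *)
(** A connected graph of even degree has an Euler circuit, and in the bipartite
    case the circuit, started in the part [A] and with any chosen edge first,
    alternates between [A] and its complement [B]. Let [q] be the number of edges
    and label them along the circuit by [1, q, 2, q - 1, ...]. Consecutive labels
    add up to [q + 1] at each passage through [B] and to [q + 2] at each passage
    through [A], except that the closing passage through the starting vertex
    contributes [q / 2 + 2]. This gives the three sums [m (q + 1)], [m (q + 2)]
    and [m (q + 2) - q / 2]. The first edge has label [1]; subtracting [1] from
    all labels turns it into [0], so that it can be deleted, and lowers every sum
    by [2 m]. Two colours never suffice because the two parts would then be colour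
    classes of equal size with equal total sum. *)

Require Import Defs.
From mathcomp Require Import all_boot.
From mathcomp Require Import zify.

Set Implicit Arguments.
Unset Strict Implicit.
Unset Printing Implicit Defensive.

(** * Edges, degrees and double counting *)

Lemma edgesP (G : sgraph) (e : {set G}) :
  reflect (exists x y : G, adj x y /\ e = [set x; y]) (e \in edges G).
Proof.
apply: (iffP imsetP) => [[[x y] /= xy ->]|[x [y [xy ->]]]]; last by exists (x, y).
by exists x, y.
Qed.

Lemma mem_edges (G : sgraph) (x y : G) : ([set x; y] \in edges G) = adj x y.
Proof.
apply/edgesP/idP => [[a [b [ab /setP E]]]|xy]; last by exists x, y.
move: (E a) (E b) ab; rewrite !inE !eqxx orbT /=.
by case/orP=> /eqP -> /orP [] /eqP ->; rewrite ?adj_irrefl // adj_sym.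
Qed.

Lemma cards_edgeI (G : sgraph) (X : {set G}) (x y : G) :
  adj x y -> #|X :&: [set x; y]| = (x \in X) + (y \in X).
Proof.
move=> xy; have x'y : x != y by apply: contraTneq xy => ->; rewrite adj_irrefl.
rewrite setIUr cardsU.
have -> : X :&: [set x] :&: (X :&: [set y]) = set0.
  apply/setP => z; rewrite !inE; case: (eqVneq z x) => [->|]; last by rewrite andbF.
  by rewrite (negbTE x'y) !andbF.
have one z : #|X :&: [set z]| = (z \in X).
  case: (boolP (z \in X)) => zX; first by rewrite (setIidPr _) ?sub1set ?cards1.
  by rewrite setIC; apply/eqP; rewrite cards_eq0 setI_eq0 disjoints1.
by rewrite cards0 subn0 !one.
Qed.

Lemma vertex_sum1 (G : sgraph) (v : G) :
  vertex_sum (fun=> 1) v = #|[set y | adj v y]|.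
Proof.
rewrite /vertex_sum sum1_card.
have inj : {in [set y | adj v y] &, injective (fun y => [set v; y])}.
  move=> y z; rewrite !inE => vy vz /setP/(_ y); rewrite !inE eqxx orbT.
  case: (eqVneq y v) vy => [->|_ _]; first by rewrite adj_irrefl.
  by move=> /esym/eqP.
rewrite -(card_in_imset inj); apply: eq_card => e.
rewrite unfold_in /=; apply/andP/imsetP => [[/edgesP [x [y [xy ->]]]]|[y]].
  rewrite !inE => /orP [] /eqP ->; first by exists y; rewrite ?inE.
  by exists x; rewrite ?inE 1?adj_sym // setUC.
by rewrite inE => vy ->; rewrite mem_edges vy !inE eqxx.
Qed.

Lemma sum_vertex_sum (G : sgraph) (f : {set G} -> nat) (X : {set G}) :
  \sum_(v in X) vertex_sum f v = \sum_(e in edges G) f e * #|X :&: e|.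
Proof.
rewrite (exchange_big_dep (mem (edges G))) /=; last by move=> ? ? _ /andP [].
apply: eq_bigr => e eE; rewrite sum_nat_const mulnC; congr (_ * _).
by apply: eq_card => v; rewrite !inE unfold_in /= eE.
Qed.

Definition bipartition (G : sgraph) (A : {set G}) : Prop :=
  forall x y : G, adj x y -> (x \in A) != (y \in A).

Lemma bipartitionC (G : sgraph) (A : {set G}) :
  bipartition A -> bipartition (~: A).
Proof. by move=> bA x y /bA; rewrite !inE; do 2!case: (_ \in A). Qed.

(** An edge meeting [S] has both ends in [S], one on each side of the bipartition, so its label
    enters both sums exactly once. *)
Lemma sum_vertex_sum_closed (G : sgraph) (f : {set G} -> nat) (A S : {set G}) :
  bipartition A -> (forall x y : G, adj x y -> (x \in S) = (y \in S)) ->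
  \sum_(v in S :&: A) vertex_sum f v = \sum_(v in S :\: A) vertex_sum f v.
Proof.
move=> bA cS; rewrite !sum_vertex_sum; apply: eq_bigr => e /edgesP [x [y [xy ->]]].
rewrite !cards_edgeI // !inE (cS _ _ xy).
by move: (bA _ _ xy); do 3!case: (_ \in _).
Qed.

Lemma card_edges_bipartition (G : sgraph) (k : nat) (A : {set G}) :
  bipartition A -> regular_graph G k -> #|edges G| = k * #|A|.
Proof.
move=> bA rG; have := sum_vertex_sum (fun=> 1) A.
under eq_bigr do rewrite vertex_sum1 rG.
rewrite sum_nat_const mulnC => ->; rewrite -sum1_card.
apply: eq_bigr => e /edgesP [x [y [xy ->]]].
by rewrite cards_edgeI //; move: (bA _ _ xy); do 2!case: (_ \in A).
Qed.

(** * Lower bound: two colours never suffice *)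

Lemma three_values (T : finType) (c : T -> nat) (x y z : T) :
  size (undup (codom c)) < 3 -> c y != c x -> c z != c x -> c y = c z.
Proof.
move=> lt3 yx zx; apply/eqP; apply: contraTT lt3 => yz; rewrite -leqNgt.
have -> : 3 = size [:: c x; c y; c z] by [].
apply: uniq_leq_size; first by rewrite /= !inE negb_or !(eq_sym (c x)) yx zx yz.
by move=> t; rewrite !inE mem_undup => /or3P [] /eqP ->; apply: codom_f.
Qed.

(* [delta v] is the degree defect of [v]: zero everywhere for a regular graph,
   one at the two ends of a deleted edge. With two colours [x], [y], the vertices
   coloured [x] in [A] and [y] outside [A] form a union [S] of components;
   counting degrees in [S] shows that it meets both sides equally, and then
   counting labels forces [x = y]. *)
Lemma num_colors_ge3 (G : sgraph) (k : nat) (A : {set G}) (delta : G -> nat)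
    (f : {set G} -> nat) :
  1 < k -> 0 < #|G| -> bipartition A ->
  (forall v : G, vertex_sum (fun=> 1) v + delta v = k) ->
  \sum_(v in A) delta v <= 1 -> \sum_(v in ~: A) delta v <= 1 ->
  local_antimagic f -> 3 <= num_colors f.
Proof.
move=> k_gt1 /card_gt0P [v0 _].
(* The hypotheses are symmetric in the two sides; this choice puts [v0] in [S :&: A]. *)
wlog v0A : A / v0 \in A => [wl|] bA dg dA dB laf.
  case: (boolP (v0 \in A)) => v0A; first exact: wl v0A bA dg dA dB laf.
  apply: (wl (~: A)) => //; rewrite ?inE ?setCK //; exact: bipartitionC.
have [_ af] := laf; rewrite leqNgt; apply/negP => lt3; pose c := @vertex_sum G f.
have two u v : c u != c v0 -> c v != c v0 -> c u = c v by exact: three_values.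
pose S := [set v | (v \in A) == (c v == c v0)].
have cS x y : adj x y -> (x \in S) = (y \in S).
  move=> xy; rewrite !inE; move: (bA _ _ xy) (af _ _ xy) (two x y).
  rewrite -/(c x) -/(c y) => + nc.
  case: (eqVneq (c x) (c v0)) => [E|_]; case: (eqVneq (c y) (c v0)) => [E'|_].
  - by case: nc; rewrite E E'.
  - by do 2!case: (_ \in A).
  - by do 2!case: (_ \in A).
  - by move=> _ /(_ isT isT).
have eqS := sum_vertex_sum_closed f bA cS.
have subsum (X Y : {set G}) :
    X \subset Y -> \sum_(v in X) delta v <= \sum_(v in Y) delta v.
  by move=> sXY; rewrite [leqRHS](big_setID X) /= (setIidPr sXY) leq_addr.
have le1 := leq_trans (subsum _ _ (subsetIr S A)) dA.
have le2 : \sum_(v in S :\: A) delta v <= 1.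
  by apply: leq_trans dB; apply: subsum; rewrite setDE subsetIr.
have degs (X : {set G}) :
    \sum_(v in X) vertex_sum (fun=> 1) v + \sum_(v in X) delta v = k * #|X|.
  by rewrite -big_split /= (eq_bigr (fun=> k)) ?sum_nat_const 1?mulnC.
(* Both sides have the same degree sum and defect at most one, so [k] times the difference of their
   sizes is at most one in absolute value, while [k > 1]. *)
have eqcard : #|S :&: A| = #|S :\: A|.
  have := degs (S :&: A); have := degs (S :\: A).
  rewrite (sum_vertex_sum_closed _ bA cS).
  move: le1 le2; nia.
have v0S : v0 \in S :&: A by rewrite !inE v0A eqxx.
have : 0 < #|S :\: A| by rewrite -eqcard; apply/card_gt0P; exists v0.
case/card_gt0P => w; rewrite !inE => /andP [wA]; rewrite (negbTE wA) => wS.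
move: eqS; rewrite (eq_bigr (fun=> c v0)); last first.
  by move=> v; rewrite !inE => /andP [/[swap] ->] /eqP/esym/eqP.
rewrite [RHS](eq_bigr (fun=> c w)); last first.
  move=> v; rewrite !inE => /andP [/negbTE ->] vS.
  exact: two.
rewrite !sum_nat_const -eqcard => /eqP; rewrite eqn_pmul2l; last first.
  by apply/card_gt0P; exists v0.
by rewrite eq_sym => E; rewrite E in wS.
Qed.

(** * Trails and Euler circuits *)

Definition trail_edges (G : sgraph) (x : G) (p : seq G) : seq {set G} :=
  pairmap (fun a b => [set a; b]) x p.

Definition trail (G : sgraph) (x : G) (p : seq G) : bool :=
  path (@adj G) x p && uniq (trail_edges x p).

Lemma trail_edges_sub (G : sgraph) (x : G) (p : seq G) :
  path (@adj G) x p -> {subset trail_edges x p <= edges G}.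
Proof.
elim: p x => //= y p IH x /andP [xy yp] e; rewrite inE => /predU1P [->|].
  by rewrite mem_edges.
exact: IH.
Qed.

Lemma mem_trail_edges (G : sgraph) (x : G) (p : seq G) (e : {set G}) (v : G) :
  e \in trail_edges x p -> v \in e -> v \in x :: p.
Proof.
elim: p x => //= y p IH x; rewrite !inE => /predU1P [->|/IH h /h].
  by rewrite !inE => /orP [] ->; rewrite ?orbT.
by rewrite inE => ->; rewrite orbT.
Qed.

Lemma trail_size (G : sgraph) (x : G) (p : seq G) :
  trail x p -> size p <= #|edges G|.
Proof.
case/andP => xp up; rewrite -(size_pairmap (fun a b => [set a; b]) x p).
by rewrite cardE; apply: uniq_leq_size => // e /(trail_edges_sub xp); rewrite mem_enum.
Qed.

(** Each passage through a vertex uses two edges, so only the ends of the trail affect parity; they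
    cancel when the trail is closed. *)
Lemma odd_trail_degree (G : sgraph) (x : G) (p : seq G) (v : G) :
  path (@adj G) x p ->
  odd (count (fun e : {set G} => v \in e) (trail_edges x p)) =
  (v == x) (+) (v == last x p).
Proof.
elim: p x => [|y p IH] x /=; first by rewrite addbb.
case/andP => xy /IH; rewrite oddD => ->; rewrite !inE.
case: (eqVneq v x) => [->|_]; last by do 2!case: (v == _).
by case: eqVneq xy => [->|]; rewrite ?adj_irrefl //= addFb.
Qed.

Lemma trail_rot (G : sgraph) (x : G) (p1 p2 : seq G) (y := last x p1) :
  trail x (p1 ++ p2) -> last x (p1 ++ p2) = x ->
  [/\ trail y (p2 ++ p1), last y (p2 ++ p1) = y,
      trail_edges y (p2 ++ p1) = trail_edges y p2 ++ trail_edges x p1 &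
      trail_edges y (p2 ++ p1) =i trail_edges x (p1 ++ p2)].
Proof.
rewrite /trail /trail_edges !cat_path !pairmap_cat !last_cat -/y => + E; rewrite E.
rewrite uniq_catC [X in X && _]andbC => tr; split=> // e.
by rewrite !mem_cat orbC.
Qed.

(* A trail that is not closed can be extended at its end because an odd number
   of the edges there is used; a closed one can be rotated to a vertex that has
   an unused edge. *)
Lemma trail_extend (G : sgraph) (m : nat) (x : G) (p : seq G) :
  connected_graph G -> regular_graph G (2 * m) -> trail x p ->
  ~~ ((last x p == x) && [forall e in edges G, e \in trail_edges x p]) ->
  exists (y : G) (q : seq G), trail y q /\ size q = (size p).+1.
Proof.
move=> [_ conG] rG tp; have [xp up] := andP tp.
have ext (a b : G) (s : seq G) : trail a s -> adj (last a s) b ->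
    [set last a s; b] \notin trail_edges a s -> trail a (rcons s b).
  rewrite /trail /trail_edges -cats1 cat_path pairmap_cat cat_uniq /= andbT orbF.
  by case/andP=> -> -> -> ->.
case: eqVneq => [cl|ncl _] /=.
  move=> nall.
  have [a [b [aW ab abN]]] : exists a b : G,
      [/\ a \in x :: p, adj a b & [set a; b] \notin trail_edges x p].
    case: (boolP [exists a : G, [exists b : G,
      [&& a \in x :: p, adj a b & [set a; b] \notin trail_edges x p]]]).
      by case/existsP=> a /existsP [b /and3P [*]]; exists a, b.
    rewrite negb_exists => /forallP none.
    have used a b : a \in x :: p -> adj a b -> [set a; b] \in trail_edges x p.
      move=> aW ab; move: (none a); rewrite negb_exists => /forallP /(_ b).
      by rewrite aW ab negbK.
    (* If every edge at a visited vertex is used, the visited vertices are closed under adjacency,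
       hence are all vertices by connectedness. *)
    have all_in a : a \in x :: p.
      rewrite -(@closed_connect _ (@adj G) (mem (x :: p)) _ x a) ?conG ?inE ?eqxx //.
      apply: intro_closed; first exact: (sym_connect_sym (@adj_sym G)).
      move=> u v uv uW; apply: mem_trail_edges (used u v uW uv) _.
      by rewrite !inE eqxx orbT.
    case/negP: nall; apply/forallP => e; apply/implyP => /edgesP [a [b [ab ->]]].
    exact: used.
  case/splitPl: aW tp cl abN => p1 p2 la tp cl abN.
  have := trail_rot tp cl; rewrite la => -[tq lq _ eqE].
  exists a, (rcons (p2 ++ p1) b); split; last by rewrite size_rcons !size_cat addnC.
  by apply: ext; rewrite ?lq // eqE.
set v := last x p in ncl *.
have : odd (count (fun e : {set G} => v \in e) (trail_edges x p)).
  by rewrite odd_trail_degree // eqxx (negbTE ncl).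
case: (boolP [exists y : G, adj v y && ([set v; y] \notin trail_edges x p)]).
  case/existsP=> y /andP [vy vyN] _.
  by exists x, (rcons p y); rewrite size_rcons; split=> //; apply: ext.
rewrite negb_exists => /forallP none.
suff -> : count (fun e : {set G} => v \in e) (trail_edges x p) = 2 * m.
  by rewrite oddM.
rewrite -(rG v) -vertex_sum1 /vertex_sum sum1_card -size_filter.
rewrite -(card_uniqP (filter_uniq _ up)); apply: eq_card => e.
rewrite mem_filter [RHS]unfold_in andbC.
apply/andP/andP => -[h ve]; split=> //; first exact: trail_edges_sub h.
have [y [vy ->]] : exists y, adj v y /\ e = [set v; y].
  case/edgesP: h ve => a [b [ab ->]]; rewrite !inE => /orP [] /eqP ->.
    by exists b.
  by exists a; rewrite adj_sym setUC.
by move: (none y); rewrite vy negbK.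
Qed.

(* Euler's theorem; a given edge can be put first by rotating the circuit. *)
Lemma euler_circuit (G : sgraph) (m : nat) (d : {set G}) :
  connected_graph G -> regular_graph G (2 * m) -> d \in edges G ->
  exists (x : G) (p : seq G), [/\ trail x p, last x p = x, trail_edges x p =i edges G &
                  nth set0 (trail_edges x p) 0 = d].
Proof.
move=> cG rG dE.
have [x [p [tp cl eqE]]] : exists x p,
    [/\ @trail G x p, last x p = x & trail_edges x p =i edges G].
  have [x0 _] := card_gt0P (proj1 cG).
  suff main n (x : G) p : trail x p -> #|edges G| - size p <= n ->
    exists x p, [/\ @trail G x p, last x p = x & trail_edges x p =i edges G].
    exact: (main _ x0 [::] isT (leqnn _)).
  elim: n x p => [|n IH] x p tp szp;
    have [/andP [/eqP cl /forall_inP used]|open] :=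
      boolP ((last x p == x) && [forall e in edges G, e \in trail_edges x p]);
    try by exists x, p; split=> // e; apply/idP/idP;
      [case/andP: tp => xp _; apply: trail_edges_sub | apply: used].
  - by case: (trail_extend cG rG tp open) => y [q [/trail_size]]; lia.
  - case: (trail_extend cG rG tp open) => y [q [tq sq]]; apply: (IH y q tq).
    by have := trail_size tq; lia.
have dp : d \in trail_edges x p by rewrite eqE.
pose i := index d (trail_edges x p).
have lti : i < size p by rewrite -(size_pairmap (fun a b => [set a; b]) x p) index_mem.
have := @trail_rot G x (take i p) (drop i p); rewrite cat_take_drop.
case=> // tq lq Eq Eqm; exists (last x (take i p)), (drop i p ++ take i p).
split=> // [e|]; first by rewrite Eqm eqE.
have Ep : trail_edges x p
    = trail_edges x (take i p) ++ trail_edges (last x (take i p)) (drop i p).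
  by rewrite /trail_edges -pairmap_cat cat_take_drop.
rewrite Eq nth_cat size_pairmap size_drop subn_gt0 lti.
have := nth_index set0 dp; rewrite -/i {1}Ep nth_cat size_pairmap size_take lti.
by rewrite ltnn subnn.
Qed.

(** * Arithmetic of the zigzag labels *)

(* The labels along the circuit are [1, 2h, 2, 2h - 1, ..., h, h + 1]. *)
Definition zigzag (h i : nat) : nat := if odd i then 2 * h - i./2 else i./2.+1.

Lemma zigzag_bound (h i : nat) : i < 2 * h -> 0 < zigzag h i <= 2 * h.
Proof. by rewrite /zigzag; case: ifP; lia. Qed.

(** Even positions receive labels at most [h], odd positions labels above [h], and each half is
    strictly monotone. *)
Lemma zigzag_inj (h i j : nat) :
  i < 2 * h -> j < 2 * h -> zigzag h i = zigzag h j -> i = j.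
Proof.
rewrite /zigzag => ih jh.
have := odd_double_half i; have := odd_double_half j.
by case: (odd i); case: (odd j) => /=; lia.
Qed.

Lemma sum_pairs (h : nat) (F : nat -> nat) :
  \sum_(i < 2 * h) F i = \sum_(j < h) (F j.*2 + F j.*2.+1).
Proof.
elim: h => [|h IH]; first by rewrite !big_ord0.
by rewrite mulnS add2n !big_ord_recr /= IH mul2n addnA.
Qed.

(** Number of ends at [v] of the [i]-th step of the walk [w]; this keeps the label arithmetic free
    of graphs. *)
Definition incidence (T : eqType) (w : nat -> T) (v : T) (i : nat) : nat :=
  (v == w i) + (v == w i.+1).

(** A visit at position [2j + 1] lies between the labels [j + 1] and [2h - j]. The factor 2 appears
    because each visit accounts for two incidences. *)
Lemma zigzag_sum_odd (T : eqType) (w : nat -> T) (h : nat) (v : T) :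
  (forall i, i <= 2 * h -> v = w i -> odd i) ->
  2 * \sum_(i < 2 * h) incidence w v i * zigzag h i =
  (2 * h).+1 * \sum_(i < 2 * h) incidence w v i.
Proof.
move=> w_odd; rewrite (sum_pairs h (fun i => incidence w v i * zigzag h i)) sum_pairs.
rewrite !big_distrr; apply: eq_bigr => j _ /=.
have ltj := ltn_ord j.
have even0 i : i <= 2 * h -> ~~ odd i -> (v == w i) = false.
  by move=> ih ni; apply: contraNF ni => /eqP; apply: w_odd.
rewrite /incidence (even0 j.*2) ?(even0 j.*2.+2) ?odd_double //=;
  rewrite ?negbK ?odd_double; try lia.
rewrite /zigzag /= odd_double uphalf_double doubleK.
by case: (v == _) => /=; lia.
Qed.

(** A visit at position [2j + 2] inside the walk lies between the labels [2h - j] and [j + 2]. The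
    closing visit joins the labels [h + 1] and [1], hence falls short by [h]. *)
Lemma zigzag_sum_even (T : eqType) (w : nat -> T) (h : nat) (v : T) :
  w (2 * h) = w 0 ->
  (forall i, i <= 2 * h -> v = w i -> ~~ odd i) ->
  2 * (\sum_(i < 2 * h) incidence w v i * zigzag h i + (v == w 0) * h) =
  (2 * h).+2 * \sum_(i < 2 * h) incidence w v i.
Proof.
move=> w_closed w_even.
have odd0 i : i <= 2 * h -> odd i -> (v == w i) = false.
  by move=> ih oi; apply/eqP => /w_even; rewrite oi => /(_ ih).
pose c j := nat_of_bool (v == w j.*2).
have ch : c h = c 0 by rewrite /c -mul2n w_closed.
have -> : \sum_(i < 2 * h) incidence w v i = \sum_(j < h) c j + \sum_(j < h) c j.+1.
  rewrite sum_pairs -big_split; apply: eq_bigr => j _ /=; have ltj := ltn_ord j.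
  by rewrite /incidence /c (odd0 j.*2.+1) ?addn0 ?add0n //= ?odd_double //; lia.
have -> : \sum_(i < 2 * h) incidence w v i * zigzag h i =
    \sum_(j < h) c j * j.+1 + \sum_(j < h) c j.+1 * (2 * h - j).
  rewrite (sum_pairs h (fun i => incidence w v i * zigzag h i)) -big_split.
  apply: eq_bigr => j _ /=; have ltj := ltn_ord j.
  rewrite /incidence /c (odd0 j.*2.+1) ?addn0 ?add0n //= ?odd_double //; last by lia.
  by rewrite /zigzag /= odd_double uphalf_double doubleK.
have shift (F : nat -> nat) : \sum_(j < h) F j.+1 + F 0 = \sum_(j < h) F j + F h.
  transitivity (\sum_(j < h.+1) F j); last by rewrite big_ord_recr.
  by rewrite big_ord_recl addnC.
have E1 : \sum_(j < h) c j.+1 = \sum_(j < h) c j by have := shift c; lia.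
(* Cyclic reindexing: the boundary terms are [c 0 * (2h + 1)] and [c h * (h + 1)], which differ by
   [c 0 * h]. *)
have E2 : \sum_(j < h) c j.+1 * (2 * h - j) + c 0 * h =
          \sum_(j < h) c j * ((2 * h).+1 - j).
  have := shift (fun j => c j * ((2 * h).+1 - j)); rewrite ch subn0.
  under eq_bigr do rewrite subSS.
  nia.
rewrite -/(c 0) -addnA E2 E1 -big_split addnn -mul2n mulnCA; congr (2 * _).
rewrite big_distrr; apply: eq_bigr => j _ /=.
by have := ltn_ord j; rewrite -mulnDr mulnC => ltj; congr (_ * _); lia.
Qed.

(** * The labeling along an Euler circuit *)

Lemma edge_labeling_bound (G : sgraph) (f : {set G} -> nat) :
  {in edges G &, injective f} ->
  {in edges G, forall e, 0 < f e <= #|edges G|} -> edge_labeling f.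
Proof.
move=> inj bnd; split=> //.
have [] // := @uniq_min_size _ [seq f d | d in edges G] (iota 1 #|edges G|).
- rewrite map_inj_in_uniq ?enum_uniq // => d e; rewrite !mem_enum; exact: inj.
- move=> _ /mapP [e + ->]; rewrite mem_enum => /bnd.
  by rewrite mem_iota add1n ltnS.
- by rewrite size_iota size_map -cardE.
Qed.

(** Taking [F] constant 1 gives the degree, and [F] the zigzag gives the colour. Adjacent vertices
    differ, so [incidence] is 0 or 1 here. *)
Lemma sum_along_trail (G : sgraph) (x : G) (p : seq G) (F : nat -> nat) (v : G) :
  trail x p -> trail_edges x p =i edges G ->
  vertex_sum (fun e => F (index e (trail_edges x p))) v =
  \sum_(i < size p) incidence (nth x (x :: p)) v i * F i.
Proof.
case/andP=> /(pathP x) xp up eqE; rewrite /vertex_sum big_mkcondr.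
rewrite -(eq_bigl _ _ eqE) -(big_uniq _ up) (big_nth set0) big_mkord size_pairmap.
apply: eq_bigr => i _; rewrite index_uniq ?size_pairmap //.
rewrite (nth_pairmap x) // !inE /incidence /=.
have := xp i (ltn_ord i); case: (eqVneq v (nth x (x :: p) i)) => [<-|_ _] /=.
  by case: eqVneq => [<-|_ _]; rewrite ?adj_irrefl ?mul1n.
by case: (_ == _); rewrite ?mul1n.
Qed.

Lemma bipartition_trail (G : sgraph) (A : {set G}) (x : G) (p : seq G) (i : nat) :
  bipartition A -> path (@adj G) x p -> x \in A -> i <= size p ->
  (nth x (x :: p) i \in A) = ~~ odd i.
Proof.
move=> bA /(pathP x) xp xA; elim: i => [|i IH] // ip.
have := bA _ _ (xp i ip); rewrite IH ?(ltnW ip) //=.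
by case: (odd i); case: (_ \in A).
Qed.

Lemma exists_labeling (G : sgraph) (m : nat) (d : {set G}) :
  0 < m -> connected_graph G -> regular_graph G (2 * m) -> bipartite_graph G ->
  d \in edges G ->
  exists f : {set G} -> nat, [/\ local_antimagic f, num_colors f <= 3 & f d = 1].
Proof.
move=> m_gt0 cG rG [A0 bA0] dE.
have [x [p [tp cl eqE d0]]] := euler_circuit cG rG dE.
have [A bA xA] : exists2 A : {set G}, bipartition A & x \in A.
  case: (boolP (x \in A0)) => xA0; first by exists A0.
  by exists (~: A0); [exact: bipartitionC | rewrite inE].
have [xp up] := andP tp; set es := trail_edges x p in up eqE d0.
pose h := m * #|A|.
have cE : #|edges G| = 2 * h by rewrite /h mulnA; exact: card_edges_bipartition.
have szes : size es = 2 * h by rewrite -cE -(eq_card eqE); apply/esym/card_uniqP.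
have szp : size p = 2 * h by rewrite -szes size_pairmap.
(* This separates the colour [m(2h + 2) - h] of [x] from the colour [m(2h + 1)] of the other side. A
   neighbour of [x] has [2m] neighbours in [A], so [A] has at least two elements. *)
have lt_mh : m < h.
  rewrite -[m]muln1 /h ltn_pmul2l //.
  have : 0 < #|[set y | adj x y]| by rewrite rG muln_gt0.
  case/card_gt0P=> y; rewrite inE => xy.
  have yA : y \notin A by move: (bA _ _ xy); rewrite xA; case: (_ \in A).
  have : [set z | adj y z] \subset A.
    by apply/subsetP => z; rewrite inE => /bA; rewrite (negbTE yA); case: (_ \in A).
  by move/subset_leq_card; rewrite rG; lia.
pose w := nth x (x :: p).
have w_cl : w (2 * h) = w 0 by rewrite /w -szp -last_nth.
have wA i : i <= 2 * h -> (w i \in A) = ~~ odd i.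
  by rewrite -szp; exact: bipartition_trail.
pose f e := zigzag h (index e es).
have sumw v : \sum_(i < 2 * h) incidence w v i = 2 * m.
  rewrite -(rG v) -vertex_sum1 (sum_along_trail (fun=> 1) v tp eqE) szp.
  by apply: eq_bigr => i _; rewrite muln1.
have sumf v : vertex_sum f v = \sum_(i < 2 * h) incidence w v i * zigzag h i.
  by rewrite (sum_along_trail (zigzag h) v tp eqE) szp.
have sumB v : v \notin A -> vertex_sum f v = m * (2 * h).+1.
  move=> vA; apply/eqP; rewrite -(eqn_pmul2l (isT : 0 < 2)) sumf.
  rewrite zigzag_sum_odd ?sumw; first by apply/eqP; lia.
  by move=> i ih E; move: vA; rewrite E wA ?negbK.
(* The deficit [h] at [x] is added on the left to avoid truncated subtraction. *)
have sumA v : v \in A -> vertex_sum f v + (v == x) * h = m * (2 * h).+2.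
  move=> vA; apply/eqP; rewrite -(eqn_pmul2l (isT : 0 < 2)) sumf.
  rewrite (zigzag_sum_even w_cl) ?sumw; first by apply/eqP; lia.
  by move=> i ih E; move: vA; rewrite E wA.
have idx e : e \in edges G -> index e es < 2 * h by rewrite -szes index_mem eqE.
exists f; split.
- split.
    apply: edge_labeling_bound => [e e' eE e'E|e eE]; last first.
      by rewrite cE; apply/zigzag_bound/idx.
    move/(zigzag_inj (idx _ eE) (idx _ e'E)) => E.
    by rewrite -(nth_index set0 (s := es) (x := e)) ?eqE // E nth_index ?eqE.
  have main u v : u \in A -> v \notin A -> vertex_sum f u <> vertex_sum f v.
    by move=> /sumA + /sumB ->; case: (u == x) => /=; lia.
  move=> u v /bA; case: (boolP (u \in A)) => uA; case: (boolP (v \in A)) => vA //.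
    by move=> _; apply: main.
  by move=> _ /esym; apply: main.
- rewrite /num_colors.
  have -> : 3 = size [:: m * (2 * h).+1; m * (2 * h).+2; m * (2 * h).+2 - h] by [].
  apply: uniq_leq_size (undup_uniq _) _ => c; rewrite mem_undup => /codomP [v ->].
  rewrite !inE; case: (boolP (v \in A)) => [/sumA <-|/sumB ->]; last by rewrite eqxx.
  by case: (v == x); rewrite ?mul1n ?addnK ?addn0 eqxx ?orbT.
- by rewrite /f -d0 index_uniq // szes; lia.
Qed.

(** * Deleting the edge labelled 1 *)

Lemma edges_delete (G : sgraph) (d : {set G}) :
  edges (delete_edge d) = edges G :\ d :> {set {set G}}.
Proof.
apply/setP => e; rewrite in_setD1; apply/(@edgesP (delete_edge d) e)/andP.
  case=> x [y [/andP [xy xyd] E]].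
  by rewrite (E : e = [set x; y] :> {set G}) mem_edges.
by case=> ed /edgesP [x [y [xy E]]]; exists x, y; split=> //; apply/andP; rewrite -E.
Qed.

Lemma vertex_sum_delete (G : sgraph) (d : {set G}) (g : {set G} -> nat) (v : G) :
  d \in edges G ->
  vertex_sum (G := delete_edge d) g v + (v \in d) * g d = vertex_sum g v.
Proof.
move=> dE; rewrite /vertex_sum edges_delete.
rewrite [RHS]big_mkcondr [RHS](bigD1 d) //= addnC; congr addn.
  by case: (v \in d); rewrite ?mul1n.
rewrite -big_mkcondr; apply: eq_bigl => e.
by rewrite !inE [X in X && _]andbC.
Qed.

(** Lowering all labels by one gives [d] the label 0, so its removal changes no sum. By regularity
    every sum drops by the same [k], which preserves both distinctness and the number of colours. *)
Lemma local_antimagic_delete (G : sgraph) (k : nat) (d : {set G})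
    (f : {set G} -> nat) :
  regular_graph G k -> d \in edges G -> local_antimagic f -> f d = 1 ->
  local_antimagic (G := delete_edge d) (fun e => (f e).-1) /\
  num_colors (G := delete_edge d) (fun e => (f e).-1) = num_colors f.
Proof.
move=> rG dE [[inj img] af] fd.
have f_bound e : e \in edges G -> 0 < f e <= #|edges G|.
  move=> eE; have : f e \in iota 1 #|edges G| by rewrite -img image_f.
  by rewrite mem_iota add1n ltnS.
have shift (v : G) :
    vertex_sum (G := delete_edge d) (fun e => (f e).-1) v + k = vertex_sum f v.
  have := vertex_sum_delete (fun e => (f e).-1) v dE.
  rewrite fd muln0 addn0 => ->; rewrite -(rG v) -vertex_sum1 -big_split /=.
  by apply: eq_bigr => e /andP [/f_bound /andP [f0 _] _]; rewrite addn1 prednK.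
split.
  split; last by move=> u v /andP [/af + _]; rewrite -!shift => + E; rewrite E.
  have edge_in e : e \in edges (delete_edge d) -> e \in edges G /\ e != d.
    by rewrite edges_delete !inE => /andP [].
  have cE : #|edges G| = #|edges (delete_edge d)|.+1.
    by rewrite edges_delete (cardsD1 d) dE.
  apply: edge_labeling_bound =>
    [e e' /edge_in [eE _] /edge_in [e'E _] E|e /edge_in [eE ed]].
    apply: inj => //; move: (f_bound e eE) (f_bound e' e'E) E; lia.
  (* Only [d] has label 1, so the lowered labels stay positive. *)
  have : f e != 1 by rewrite -fd; apply: contraNneq ed => /inj ->.
  by have := f_bound e eE; rewrite cE; lia.
rewrite /num_colors.
have -> : codom (vertex_sum f) =
    map (addn^~ k) (codom (vertex_sum (G := delete_edge d) (fun e => (f e).-1))).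
  by rewrite /codom /image_mem -map_comp; apply: eq_map => v /=; rewrite shift.
by rewrite (undup_map_inj (@addIn k)) size_map.
Qed.

Theorem theorem2p7 (m : nat) (G : sgraph) (m_ge1 : 1 <= m)
    (G_conn : connected_graph G) (G_reg : regular_graph G (2 * m))
    (G_bip : bipartite_graph G) :
  chi_la G 3 /\
  forall d : {set G}, d \in edges G -> chi_la (delete_edge d) 3.
Proof.
have k_gt1 : 1 < 2 * m by lia.
have [A bA] := G_bip; have [G_gt0 _] := G_conn.
have lowG f : @local_antimagic G f -> 3 <= num_colors f.
  apply: (num_colors_ge3 (A := A) (delta := fun=> 0) k_gt1) => //.
  - by move=> v; rewrite addn0 vertex_sum1 G_reg.
  - by rewrite big1.
  - by rewrite big1.
have lowD (d : {set G}) (f : {set delete_edge d} -> nat) :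
    d \in edges G -> local_antimagic f -> 3 <= num_colors f.
  move=> dE; have bAd : @bipartition (delete_edge d) A by move=> x y /andP [/bA].
  (* The deleted edge has one end on each side, so the total defect is one on each side. *)
  have [cA cB] : #|A :&: d| = 1 /\ #|~: A :&: d| = 1.
    have /edgesP [x [y [xy ->]]] := dE; rewrite !cards_edgeI // !inE.
    by move: (bA _ _ xy); do 2!case: (_ \in A).
  have sum_in (X : {set G}) : \sum_(v in X) (v \in d : nat) = #|X :&: d|.
    rewrite -big_mkcondr sum1_card; apply: eq_card => v.
    by rewrite !inE.
  apply: (@num_colors_ge3 (delete_edge d) _ A (fun v => v \in d) f k_gt1 _ bAd) => //.
  - move=> v; have := @vertex_sum_delete G d (fun=> 1) v dE.
    by rewrite muln1 vertex_sum1 G_reg.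
  - exact: eq_leq (etrans (sum_in _) cA).
  - exact: eq_leq (etrans (sum_in _) cB).
have [x _] := card_gt0P G_gt0.
(* For [G] itself any edge can serve as the first one; positive degree provides it. *)
have : 0 < #|[set y | adj x y]| by rewrite G_reg; lia.
case/card_gt0P=> y; rewrite inE -mem_edges => xyE.
split; last move=> d dE.
  have [f [af le3 _]] := exists_labeling m_ge1 G_conn G_reg G_bip xyE.
  by split=> //; exists f => //; apply/eqP; rewrite eqn_leq le3 lowG.
have [f [af le3 fd]] := exists_labeling m_ge1 G_conn G_reg G_bip dE.
have [ag cg] := local_antimagic_delete G_reg dE af fd.
split=> [|f' af']; last exact: lowD.
by exists (fun e => (f e).-1) => //; apply/eqP; rewrite eqn_leq cg le3 lowG.
Qed.
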